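(* Let $(X,\|\cdot\|)$ be a Banach space, $C\subseteq X$ a closed convex set, and $T:C\to C$ a nonexpansive map. Let $(\alpha_n)_{n\ge 1}$ be a sequence in $[0,1]$, $(e_n)_{n\ge 1}$ a sequence in $X$, $x_0\in C$, and let $(x_n)_{n\in\mathbb{N}}$ be generated by $$x_{n+1}=(1-\alpha_{n+1})\,x_n+\alpha_{n+1}\,(Tx_n+e_{n+1}),\qquad n\in\mathbb{N}.$$ Assume that there exists $\kappa\in[0,\infty)$ such that $x_n\in C$ and $\|Tx_n-x_0\|\le\kappa$ for all $n\in\mathbb{N}$. Suppose that $\alpha_n$ is bounded away from $0$ and $1$, and $\|e_n\|=O(1/n^a)$ as $n\to\infty$. (a) If $\frac12\le a<1$ then $\|x_n-Tx_n\|=O(1/n^{a-1/2})$. (b) If $a=1$ then $\|x_n-Tx_n\|=O(\log n/\sqrt n)$. (c) If $a>1$ then $\|x_n-Tx_n\|=O(1/\sqrt n)$.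
   Context: $\mathbb{N}=\{0,1,2,\dots\}$. $T$ nonexpansive means $\|Tx-Ty\|\le\|x-y\|$ for all $x,y$ in its domain. ''Bounded away from $0$ and $1$'' means there is $\delta>0$ with $\delta\le\alpha_n\le1-\delta$ for all $n\ge1$. All $O(\cdot)$ are as $n\to\infty$. *)

(* Defs.v *)
From HB Require Import structures.
From mathcomp Require Export all_boot all_order all_algebra.
From mathcomp Require Export all_classical all_reals all_analysis.
Export Order.TTheory GRing.Theory Num.Theory.
Export numFieldNormedType.Exports.
Set Implicit Arguments.
Unset Strict Implicit.
Unset Printing Implicit Defensive.

(* Sequences indexed by n >= 1 are represented by functions on nat whose value
   at 0 is arbitrary; only indices n >= 1 are constrained. *)
Definition bounded_away01 (R : realType) (alpha : nat -> R) : Prop :=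
  exists2 delta : R, (0 < delta)%R &
    forall n : nat, (1 <= n)%N -> (delta <= alpha n <= 1 - delta)%R.

(* Main.v *)
Require Import Defs.
From mathcomp Require Import all_boot all_order all_algebra.
From mathcomp Require Import all_classical all_reals all_analysis.
From mathcomp Require Import ring lra zify.
Import Order.TTheory GRing.Theory Num.Theory.
Import numFieldNormedType.Exports.
Local Open Scope classical_set_scope.
Local Open Scope ring_scope.

(** Put D(m,n) = |x_m - x_n| and E(m,n) = |x_m - T x_n| for m <= n, and
    eps_n = |e_n|. Expanding x_n, respectively x_(m+1), by one step of the
    iteration and using that T is nonexpansive gives
      D(m,n+1) <= (1 - alpha_(n+1)) D(m,n) + alpha_(n+1) (E(m,n) + eps_(n+1)),
      E(m+1,n) <= (1 - alpha_(m+1)) E(m,n) + alpha_(m+1) (D(m,n) + eps_(m+1)),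
    with D(m,m) = 0 and E(0,n) <= kappa. The residual |x_n - T x_n| is E(n,n).

    Unrolling these inequalities describes two independent Bernoulli scans of
    the indices, both with success probabilities alpha_i: a hare starting from
    n and a fox starting from m. Only the lead of the hare over the fox matters,
    and on the indices scanned by both it is a lazy symmetric random walk whose
    steps +1 and -1 have probability alpha_i (1 - alpha_i) each, killed when the
    fox catches up. Accordingly, D(m,n) and E(m,n) are bounded
    ([double_recursion_bound]) by the mean of P_m(y + B), where y = 0 for D and
    y = 1 for E and B is the sum of independent Bernoulli variables over the
    indices in (m, n], plus the sum of alpha_i eps_i over (m, n]. Here P is any
    nonnegative supersolution of the recursion satisfied by the walk
    with source 2 alpha_m eps_m and initial value kappa.

    An explicit supersolution replaces the analysis of the walk: if
    0 < b <= alpha_i (1 - alpha_i), the function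
      W_t(y) = min(1, 2 y / (y + sqrt(1 + b t)))
    dominates the probability of surviving t steps from y ([barrier_super]), and
    P_m = kappa W_m + sum_(1 <= i <= m) 2 alpha_i eps_i W_(m-i).
    As W_t(1) = O(1/sqrt(t+1)), this yields ([inexact_km_bound])
      |x_n - T x_n| <= K (kappa / sqrt(n+1)
                          + 2 sum_(1 <= i <= n) eps_i / sqrt(n - i + 1)).
    The three rates follow by inserting eps_i = O(i^-a) into the convolution
    ([convolution_bound]) and from the growth of the sums of i^-a for a < 1,
    a = 1 and a > 1. *)

(** * A barrier for the killed random walk *)

(** Upper bound for the probability that a lazy symmetric walk on nat started
    at [y], moving up and down with probability at least [b] each, is not
    absorbed at 0 within [t] steps. The truncation at 1 is essential: the
    rational function satisfies the inequality of a supersolution in the region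
    y <= sqrt(1 + b t), where it is at most 1, but not for much larger y. *)
Definition barrier {R : realType} (b : R) (t y : nat) : R :=
  Num.min 1 (2 * y%:R / (y%:R + Num.sqrt (1 + b * t%:R))).

Lemma barrier_ge0 {R : realType} (b : R) (t y : nat) : 0 <= barrier b t y.
Proof.
by rewrite le_min ler01 divr_ge0 ?mulr_ge0 ?addr_ge0 ?sqrtr_ge0 ?ler0n.
Qed.

Lemma barrier_start {R : realType} (b : R) (y : nat) : barrier b 0 y.+1 = 1.
Proof.
rewrite /barrier mulr0 addr0 sqrtr1 min_l//.
rewrite ler_pdivlMr; last by rewrite ltr_wpDl.
by rewrite mul1r mulr2n mulrDl mul1r lerD2l ler1n.
Qed.

Lemma barrier_le {R : realType} (b : R) (t : nat) : 0 < b <= 1 ->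
  barrier b t 1 <= 2 / Num.sqrt b / Num.sqrt t.+1%:R.
Proof.
move=> /andP[b0 b1].
rewrite ge_min; apply/orP; right.
rewrite mulr1 -[leRHS]mulrA ler_pM2l// -invfM -sqrtrM ?(ltW b0)//.
rewrite lef_pV2 ?posrE ?ltr_wpDr ?sqrtr_ge0 ?sqrtr_gt0 ?mulr_gt0//.
rewrite (@le_trans _ _ (Num.sqrt (1 + b * t%:R)))//; last by rewrite lerDr.
rewrite ler_sqrt -?natr1 ?mulrDr ?mulr1; last first.
  by rewrite addr_ge0// mulr_ge0// ltW.
by rewrite addrC lerD2r.
Qed.

(** The barrier is a supersolution for every admissible laziness. Where the
    rational function V_t(y) = 2 y / (y + r_t), r_t = sqrt(1 + b t), stays below
    1 at time t + 1, its decrease in time is compensated by its concavity in y;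
    the comparison reduces to b r_(t+1) <= 2 beta r_t. *)
Lemma barrier_super {R : realType} (b beta : R) (t y : nat) :
  0 < b <= beta -> beta <= 1 / 2 ->
  (1 - 2 * beta) * barrier b t y.+1
    + beta * (barrier b t y + barrier b t y.+2) <= barrier b t.+1 y.+1.
Proof.
move=> /andP[b0 bbeta] beta2.
have beta0 : 0 <= beta by lra.
rewrite [leRHS]/barrier le_min; apply/andP; split.
  have W1 k : barrier b t k <= 1 by rewrite ge_min lexx.
  (* A convex combination of values at most 1. *)
  have := W1 y; have := W1 y.+1; have := W1 y.+2; nra.
(* Where V_(t+1)(y + 1) >= 1 the truncation makes the claim trivial. *)
have [r'y|yr'] := leP (Num.sqrt (1 + b * t.+1%:R)) y.+1%:R.
  have W1 k : barrier b t k <= 1 by rewrite ge_min lexx.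
  rewrite (@le_trans _ _ 1)//.
    have := W1 y; have := W1 y.+1; have := W1 y.+2; nra.
  have y0 : (0 : R) < y.+1%:R by [].
  have r0 := sqrtr_ge0 (1 + b * t.+1%:R).
  rewrite ler_pdivlMr; lra.
have bt0 : 0 <= b * t%:R by rewrite mulr_ge0// ltW.
have bt0' : 0 <= b * t.+1%:R by rewrite mulr_ge0// ltW.
have W2 k : barrier b t k <= 2 * k%:R / (k%:R + Num.sqrt (1 + b * t%:R)).
  by rewrite ge_min lexx orbT.
move: (W2 y) (W2 y.+1) (W2 y.+2); move: yr'.
have : Num.sqrt (1 + b * t.+1%:R) ^+ 2 = Num.sqrt (1 + b * t%:R) ^+ 2 + b.
  by rewrite !sqr_sqrtr ?addr_ge0// -natr1; ring.
have : 1 <= Num.sqrt (1 + b * t%:R) by rewrite -[leLHS]sqrtr1 ler_sqrt; lra.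
have : 0 <= Num.sqrt (1 + b * t.+1%:R) by rewrite sqrtr_ge0.
have : 0 <= y%:R :> R by [].
have -> : y.+2%:R = y%:R + 2 :> R by rewrite -addn2 natrD.
have -> : y.+1%:R = y%:R + 1 :> R by rewrite -addn1 natrD.
move: (barrier b t y) (barrier b t y.+1) (barrier b t y.+2) => w0 w1 w2.
set r := Num.sqrt (1 + b * t%:R); set r' := Num.sqrt (1 + b * t.+1%:R).
move: r r' (y%:R : R) => r r' z z0 r'0 r1 rr' zr' w0le w1le w2le.
apply: (@le_trans _ _ ((1 - 2 * beta) * (2 * (z + 1) / (z + 1 + r))
   + beta * (2 * z / (z + r) + 2 * (z + 2) / (z + 2 + r)))).
  by apply: lerD; apply: ler_wpM2l; [lra| |lra|apply: lerD].
rewrite -subr_ge0.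
have -> : 2 * (z + 1) / (z + 1 + r')
   - ((1 - 2 * beta) * (2 * (z + 1) / (z + 1 + r))
   + beta * (2 * z / (z + r) + 2 * (z + 2) / (z + 2 + r))) =
  2 / ((z + 1 + r) * (z + 1 + r')) * (2 * beta * r * (z + 1 + r')
       / ((z + r) * (z + 2 + r))
     - (r' - r) * (z + 1)).
  by field; do !(apply/andP; split); apply: lt0r_neq0; lra.
(* It remains to bound (r' - r)(z + 1) through (r' - r)(r' + r) = b. *)
have rr'_le : r <= r' by nra.
have r'2r : r' <= 2 * r by nra.
apply: mulr_ge0; first by rewrite divr_ge0// mulr_ge0//; lra.
rewrite subr_ge0 ler_pdivlMr; last by rewrite mulr_gt0//; lra.
have zz : (z + r) * (z + 2 + r) <= (z + 1 + r) ^+ 2 by nra.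
apply: (@le_trans _ _ ((r' - r) * (z + 1) * ((z + 1 + r) * (z + 1 + r')))).
  apply: ler_wpM2l; first by rewrite mulr_ge0//; lra.
  by apply: (le_trans zz); rewrite expr2; apply: ler_wpM2l; lra.
rewrite mulrA; apply: ler_wpM2r; first by lra.
apply: (@le_trans _ _ ((r' - r) * r' * (r' + r))).
  by rewrite -!mulrA; apply: ler_wpM2l; [lra|apply: ler_pM; lra].
have -> : (r' - r) * r' * (r' + r) = (r' ^+ 2 - r ^+ 2) * r' by ring.
by rewrite rr' addrC addKr; nra.
Qed.

(** * Unrolling the double recursion *)

(** The mean of f(y + B_(m+1) + ... + B_(m+k)), where the B_i are independent
    Bernoulli variables of parameter alpha_i. *)
Fixpoint bernoulli_mean {R : realType} (alpha : nat -> R) (m k : nat)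
    (f : nat -> R) (y : nat) : R :=
  if k is k'.+1 then
    (1 - alpha (m + k').+1) * bernoulli_mean alpha m k' f y
      + alpha (m + k').+1 * bernoulli_mean alpha m k' f y.+1
  else f y.

Lemma bernoulli_mean_le {R : realType} (alpha : nat -> R) (m k : nat)
    (f g : nat -> R) :
  (forall n, 0 <= alpha n.+1 <= 1) -> (forall y, f y <= g y) ->
  forall y, bernoulli_mean alpha m k f y <= bernoulli_mean alpha m k g y.
Proof.
move=> a01 fg; elim: k => [|k IH] y //=.
by have /andP[a0 a1] := a01 (m + k)%N; rewrite lerD ?ler_wpM2l ?subr_ge0.
Qed.

Lemma bernoulli_mean_shift {R : realType} (alpha : nat -> R) (m k : nat)
    (f : nat -> R) (y : nat) :
  bernoulli_mean alpha m k (fun z => f z.+1) y = bernoulli_mean alpha m k f y.+1.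
Proof. by elim: k y => [|k IH] y //=; rewrite !IH. Qed.

(** Averaging commutes with translations, hence with the generator of the
    walk. *)
Lemma bernoulli_mean_affine {R : realType} (alpha : nat -> R) (m k : nat)
    (f : nat -> R) (p q c : R) (y : nat) :
  bernoulli_mean alpha m k (fun z => p * f z.+1 + q * (f z + f z.+2) + c) y =
  p * bernoulli_mean alpha m k f y.+1
    + q * (bernoulli_mean alpha m k f y + bernoulli_mean alpha m k f y.+2) + c.
Proof. by elim: k y => [|k IH] y //=; rewrite !IH; ring. Qed.

(** The definition conditions on the variable of highest index; by
    independence one can condition on that of lowest index instead. *)
Lemma bernoulli_mean_recl {R : realType} (alpha : nat -> R) (m k : nat)
    (f : nat -> R) (y : nat) :
  bernoulli_mean alpha m k.+1 f y =
  (1 - alpha m.+1) * bernoulli_mean alpha m.+1 k f y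
    + alpha m.+1 * bernoulli_mean alpha m.+1 k f y.+1.
Proof.
elim: k y => [|k IH] y; first by rewrite /= addn0.
rewrite -[LHS]/((1 - alpha (m + k.+1).+1) * bernoulli_mean alpha m k.+1 f y
      + alpha (m + k.+1).+1 * bernoulli_mean alpha m k.+1 f y.+1) !IH /=
  addSnnS; ring.
Qed.

Lemma bernoulli_mean_ge_cst {R : realType} (alpha : nat -> R) (m k : nat)
    (f : nat -> R) (c : R) :
  (forall n, 0 <= alpha n.+1 <= 1) -> (forall y, c <= f y) ->
  forall y, c <= bernoulli_mean alpha m k f y.
Proof.
move=> a01 cf; elim: k => [|k IH] y //=.
have /andP[a0 a1] := a01 (m + k)%N.
have := IH y; have := IH y.+1; nra.
Qed.

(** Comparison principle for the double recursion; the second index of [D] and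
    [E] is the offset k = n - m. Advancing n conditions on the Bernoulli variable
    of highest index, while advancing m removes the variable of lowest index and
    combines it with the step of the fox into one step of the lazy walk. The
    source carries a factor 2 because the error at index m + 1 is met both in
    the scan of the fox and, through the additive sum, in that of the hare. *)
Lemma double_recursion_bound {R : realType} (alpha eps : nat -> R) (kappa : R)
    (P D E : nat -> nat -> R) :
  (forall n, 0 <= alpha n.+1 <= 1) -> (forall n, 0 <= eps n) ->
  (forall m, D m 0%N <= 0) -> (forall k, E 0%N k <= kappa) ->
  (forall m k, D m k.+1 <= (1 - alpha (m + k).+1) * D m k
     + alpha (m + k).+1 * (E m k + eps (m + k).+1)) ->
  (forall m k, E m.+1 k <= (1 - alpha m.+1) * E m k.+1
     + alpha m.+1 * (D m k.+1 + eps m.+1)) ->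
  (forall m, 0 <= P m 0%N) -> (forall y, kappa <= P 0%N y.+1) ->
  (forall m y, let beta := alpha m.+1 * (1 - alpha m.+1) in
     (1 - 2 * beta) * P m y.+1 + beta * (P m y + P m y.+2)
       + 2 * (alpha m.+1 * eps m.+1) <= P m.+1 y.+1) ->
  forall m k, E m k <= bernoulli_mean alpha m k (P m) 1
     + \sum_(m <= i < m + k) alpha i.+1 * eps i.+1.
Proof.
move=> a01 eps0 D0 E0 DS ES P0 Pk PS.
have ae0 i : 0 <= alpha i.+1 * eps i.+1.
  by rewrite mulr_ge0//; have /andP[] := a01 i.
pose S m k := \sum_(m <= i < m + k) alpha i.+1 * eps i.+1.
have SS m k : S m k.+1 = S m k + alpha (m + k).+1 * eps (m + k).+1.
  by rewrite /S addnS big_nat_recr ?leq_addr.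
have SS' m k : S m k.+1 = alpha m.+1 * eps m.+1 + S m.+1 k.
  by rewrite /S addnS big_ltn ?ltnS ?leq_addr// addSn.
(* For fixed m the bound on E gives that on D, by induction on the offset. *)
have DE m : (forall k, E m k <= bernoulli_mean alpha m k (P m) 1 + S m k) ->
    forall k, D m k <= bernoulli_mean alpha m k (P m) 0 + S m k.
  move=> EH; elim=> [|k IH].
    rewrite /S addn0 big_geq// addr0; exact: le_trans (D0 m) (P0 m).
  apply: le_trans (DS m k) _; rewrite SS /=.
  have /andP[a0 a1] := a01 (m + k)%N.
  have := EH k; move: IH.
  move: (bernoulli_mean alpha m k (P m) 0)
    (bernoulli_mean alpha m k (P m) 1) => J0 J1.
  move: (D m k) (E m k) (S m k) (eps _) => d e' s ep.
  move: a0 a1; set a := alpha _; move: a => a a0 a1; nra.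
elim=> [|m IHm] k.
  apply: (@le_trans _ _ kappa); first exact: E0.
  rewrite -bernoulli_mean_shift -[leLHS]addr0; apply: lerD.
    exact: bernoulli_mean_ge_cst.
  exact: sumr_ge0.
rewrite -/(S m.+1 k).
have HE := IHm k.+1; have HD := DE m IHm k.+1; apply: le_trans (ES m k) _.
have := @bernoulli_mean_le _ alpha m.+1 k _ _ a01 (PS m) 0%N.
rewrite bernoulli_mean_affine bernoulli_mean_shift.
move: HE HD; rewrite -/(S m k.+1) SS' !bernoulli_mean_recl.
have /andP[a0 a1] := a01 m.
move: (bernoulli_mean alpha m.+1 k (P m) 0)
  (bernoulli_mean alpha m.+1 k (P m) 1)
  (bernoulli_mean alpha m.+1 k (P m) 2)
  (bernoulli_mean alpha m.+1 k (P m.+1) 1) => J0 J1 J2 J.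
move: (D m k.+1) (E m k.+1) (S m.+1 k) (eps m.+1) => d e' s ep.
move: a0 a1; set a := alpha _; move: a => a a0 a1 HE HD HJ.
have := ler_wpM2l a0 HD.
have : (1 - a) * e' <= (1 - a) * ((1 - a) * J1 + a * J2 + (a * ep + s)).
  by apply: ler_wpM2l => //; lra.
lra.
Qed.

(** * The residual of the inexact iteration *)

(** The supersolution assembled from the barrier: the initial value [kappa]
    survives for [m] steps, and the error made at index i + 1 for the
    [m - i.+1] remaining ones. *)
Definition potential {R : realType} (alpha eps : nat -> R) (kappa b : R)
    (m y : nat) : R :=
  kappa * barrier b m y
    + \sum_(0 <= i < m) 2 * (alpha i.+1 * eps i.+1) * barrier b (m - i.+1) y.

Lemma potential_super {R : realType} (alpha eps : nat -> R) (kappa b : R)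
    (m y : nat) (beta := alpha m.+1 * (1 - alpha m.+1)) :
  0 <= kappa -> 0 < b <= beta ->
  (forall n, 0 <= alpha n.+1 <= 1) -> (forall n, 0 <= eps n) ->
  (1 - 2 * beta) * potential alpha eps kappa b m y.+1
    + beta * (potential alpha eps kappa b m y
              + potential alpha eps kappa b m y.+2)
    + 2 * (alpha m.+1 * eps m.+1) <= potential alpha eps kappa b m.+1 y.+1.
Proof.
move=> k0 bbeta a01 eps0.
have beta2 : beta <= 1 / 2.
  by rewrite /beta; move: (alpha m.+1) => a; have := sqr_ge0 (1 - 2 * a); nra.
have W t := barrier_super b beta t y bbeta beta2.
rewrite /potential big_nat_recr//= subnn barrier_start mulr1 [leRHS]addrA lerD2r.
have -> (k : R) s1 s2 s3 (w1 w2 w3 : R) :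
    (1 - 2 * beta) * (k * w2 + s2) + beta * (k * w1 + s1 + (k * w3 + s3)) =
    k * ((1 - 2 * beta) * w2 + beta * (w1 + w3))
    + ((1 - 2 * beta) * s2 + beta * (s1 + s3)) by ring.
apply: lerD; first by rewrite ler_wpM2l.
rewrite -big_split !mulr_sumr -big_split/= !big_nat.
apply: ler_sum => i /andP[_ im].
rewrite subSS -(subnSK im).
set c := 2 * (alpha _ * _).
have c0 : 0 <= c.
  by rewrite mulr_ge0// mulr_ge0//; have /andP[] := a01 i.
have := ler_wpM2l c0 (W (m - i.+1)%N); lra.
Qed.

(** Nonasymptotic estimate of the residual: the bound kappa and each error
    are discounted by the inverse square root of the number of steps elapsed. *)
Lemma inexact_km_bound {R : realType} (X : normedModType R) (C : set X)
    (T : X -> X) (alpha : nat -> R) (e x : nat -> X) (kappa delta : R) :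
  (forall u v, C u -> C v -> `|T u - T v| <= `|u - v|) ->
  0 < delta -> (forall n, delta <= alpha n.+1 <= 1 - delta) ->
  (forall n, C (x n)) -> (forall n, `|T (x n) - x 0%N| <= kappa) ->
  (forall n,
     x n.+1 = (1 - alpha n.+1) *: x n + alpha n.+1 *: (T (x n) + e n.+1)) ->
  forall n, `|x n - T (x n)| <= 2 / Num.sqrt (delta * (1 - delta)) *
    (kappa / Num.sqrt n.+1%:R
     + 2 * \sum_(0 <= i < n) `|e i.+1| / Num.sqrt (n - i)%:R).
Proof.
move=> Tne d0 ad Cx xk xS n.
have a01 k : 0 <= alpha k.+1 <= 1 by have := ad k; lra.
have k0 : 0 <= kappa := le_trans (normr_ge0 _) (xk 0%N).
pose b := delta * (1 - delta).
have d1 : delta <= 1 - delta by have := ad 0%N; lra.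
have b0 : 0 < b by rewrite /b mulr_gt0//; lra.
have b1 : b <= 1 by rewrite /b; nra.
have bbeta m : 0 < b <= alpha m.+1 * (1 - alpha m.+1).
  by rewrite b0 /=; have := ad m; rewrite /b; nra.
pose eps m := `|e m|.
have eps0 m : 0 <= eps m by exact: normr_ge0.
(* Convexity bound of the distance from x_(m+1) to an arbitrary point; it
   gives both recursions. *)
have step z m : `|z - x m.+1| <= (1 - alpha m.+1) * `|z - x m|
    + alpha m.+1 * (`|z - T (x m)| + eps m.+1).
  have /andP[a0 a1] := a01 m.
  have -> : z - x m.+1 = (1 - alpha m.+1) *: (z - x m)
     + alpha m.+1 *: (z - T (x m) - e m.+1).
    rewrite xS -addrA -opprD !scalerBr addrACA -scalerDl subrK scale1r.
    by rewrite -opprD.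
  apply: le_trans (ler_normD _ _) _.
  rewrite !normrZ !ger0_norm ?subr_ge0// lerD2l ler_wpM2l//.
  exact: ler_normB.
have := @double_recursion_bound R alpha eps kappa (potential alpha eps kappa b)
  (fun m k => `|x m - x (m + k)%N|) (fun m k => `|x m - T (x (m + k)%N)|)
  a01 eps0.
move=> /(_ _ _ _ _ _ _ _ n 0%N); rewrite addn0 big_geq// addr0 => Bn.
apply: le_trans (Bn _ _ _ _ _ _ _) _.
- by move=> m; rewrite addn0 subrr normr0.
- by move=> k; rewrite add0n distrC.
- by move=> m k; rewrite addnS; exact: step.
- move=> m k; rewrite addSnnS distrC; apply: le_trans (step _ _) _.
  have /andP[a0 a1] := a01 m.
  rewrite lerD ?ler_wpM2l ?subr_ge0//; first by rewrite distrC.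
  by rewrite lerD2r distrC; exact: Tne.
- move=> m; rewrite /potential addr_ge0//.
    by rewrite mulr_ge0 ?barrier_ge0.
  apply: sumr_ge0 => i _; rewrite !mulr_ge0 ?barrier_ge0//.
  by have /andP[] := a01 i.
- by move=> y; rewrite /potential barrier_start mulr1 big_geq// addr0.
- by move=> m y; exact: potential_super.
have W t := barrier_le b t.
have c0 : 0 <= 2 / Num.sqrt b by rewrite divr_ge0 ?sqrtr_ge0.
rewrite /= /potential mulrDr; apply: lerD.
  rewrite mulrCA ler_wpM2l// W// b0//.
rewrite mulrCA !mulr_sumr !big_nat; apply: ler_sum => i /andP[_ i_n].
rewrite -!mulrA ler_wpM2l//.
have /andP[ai0 ai1] := a01 i.
apply: (@le_trans _ _ (eps i.+1 * barrier b (n - i.+1) 1)).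
  by rewrite ler_piMl// mulr_ge0 ?barrier_ge0.
have -> : 2 * ((Num.sqrt b)^-1 * (`|e i.+1| / Num.sqrt (n - i)%:R)) =
   eps i.+1 * (2 / Num.sqrt b / Num.sqrt (n - i)%:R) by rewrite /eps; ring.
by rewrite ler_wpM2l// -(subnSK i_n) W// b0.
Qed.

(** * Power sums and their convolution with the inverse square root *)

(** Obtained as a convex combination of the tangent inequality
    1 + v <= exp(v) at v = (1 - s) ln u and at v = - s ln u. *)
Lemma bernoulli_powR {R : realType} (u s : R) : 0 < u -> 0 <= s <= 1 ->
  u `^ s <= 1 + s * (u - 1).
Proof.
move=> u0 /andP[s0 s1].
have u1 v : u `^ v = expR (v * ln u) by rewrite /powR gt_eqF.
have us : 0 < u `^ s by rewrite powR_gt0.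
have h1 := expR_ge1Dx ((1 - s) * ln u); have h2 := expR_ge1Dx (- s * ln u).
rewrite -!u1 in h1 h2.
have e1 : u `^ s * u `^ (1 - s) = u.
  by rewrite -powRD ?(gt_eqF u0) ?implybT// subrKC powRr1// ltW.
have e2 : u `^ s * u `^ (- s) = 1.
  by rewrite -powRD ?(gt_eqF u0) ?implybT// subrr powRr0.
have : 1 <= s * u `^ (1 - s) + (1 - s) * u `^ (- s) by nra.
move=> /(ler_wpM2l (ltW us)); rewrite mulr1 mulrDr !(mulrCA (u `^ s)) e1 e2.
lra.
Qed.

Lemma powR_inv_split {R : realType} (N a : R) : 0 < N ->
  (N `^ a)^-1 = N `^ (1 - a) / N.
Proof.
move=> N0; rewrite powRB; last by rewrite (gt_eqF N0) implybT.
by rewrite powRr1 ?(ltW N0)// mulrAC mulfV ?(gt_eqF N0)// mul1r.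
Qed.

Lemma sum_powR_lt1 {R : realType} (a : R) (n : nat) : 0 <= a < 1 ->
  \sum_(0 <= i < n) (i.+1%:R `^ a)^-1 <= n%:R `^ (1 - a) / (1 - a).
Proof.
move=> /andP[a0 a1].
have s0 : 0 < 1 - a by lra.
elim: n => [|n IH]; first by rewrite big_geq// divr_ge0 ?powR_ge0// ltW.
rewrite big_nat_recr//=; apply: le_trans (lerD IH (lexx _)) _.
rewrite ler_pdivlMr// mulrDl mulfVK ?gt_eqF//.
(* Telescoping step: (1 - a) N^-a <= N^(1-a) - (N-1)^(1-a); the case N = 1 is
   separate since 0 `^ (1 - a) is not covered by the Bernoulli inequality. *)
have n0 : 0 < n.+1%:R :> R by [].
case: n {IH} n0 => [|n] n0.
  by rewrite powR0 ?gt_eqF// !powR1 invr1 mul1r; lra.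
set N : R := n.+2%:R in n0 *.
have -> : n.+1%:R = N * ((N - 1) / N) :> R.
  by rewrite mulrCA mulfV ?gt_eqF// mulr1 /N -(natr1 n.+1) addrK.
have N1 : 0 < N - 1 by rewrite subr_gt0 ltr1n.
rewrite powRM ?divr_ge0 ?(ltW N1) ?(ltW n0)//.
have := @bernoulli_powR R ((N - 1) / N) (1 - a); rewrite divr_gt0// => /(_ isT).
have -> : 0 <= 1 - a <= 1 by apply/andP; split; lra.
move=> /(_ isT) /(ler_wpM2l (powR_ge0 N (1 - a))) h.
apply: le_trans (lerD h (lexx _)) _.
have -> : (N `^ a)^-1 = N `^ (1 - a) / N.
  exact: powR_inv_split.
rewrite le_eqVlt; apply/orP; left; apply/eqP; field; exact: lt0r_neq0.
Qed.

Lemma inv_le_lnB {R : realType} (n : nat) :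
  n.+2%:R^-1 <= ln n.+2%:R - ln n.+1%:R :> R.
Proof.
have h : -1 < - n.+2%:R^-1 :> R by rewrite ltrN2 invf_lt1 ?ltr1n.
have := le_ln1Dx h.
have -> : 1 - n.+2%:R^-1 = n.+1%:R / n.+2%:R :> R.
  by rewrite -[in RHS](addrK 1 n.+1%:R) natr1 mulrBl mulfV// mul1r.
by rewrite ln_div ?posrE// lerNr opprB.
Qed.

Lemma sum_inv_le_ln {R : realType} (n : nat) :
  \sum_(0 <= i < n.+1) i.+1%:R^-1 <= 1 + ln n.+1%:R :> R.
Proof.
elim: n => [|n IH]; first by rewrite big_nat1 invr1 ln1 addr0.
rewrite big_nat_recr//=; apply: le_trans (lerD IH (inv_le_lnB n)) _.
by rewrite -addrA subrKC.
Qed.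

Lemma sum_powR_gt1 {R : realType} (a : R) (n : nat) : 1 < a ->
  \sum_(0 <= i < n) (i.+1%:R `^ a)^-1 <= 1 + (a - 1)^-1.
Proof.
move=> a1; have s0 : 0 < a - 1 by lra.
case: n => [|n].
  by rewrite big_geq// addr_ge0// invr_ge0 ltW.
(* The strengthened bound 1 + (1 - N^(1-a)) / (a - 1) telescopes. *)
apply: (@le_trans _ _ (1 + (1 - n.+1%:R `^ (1 - a)) / (a - 1))); last first.
  by rewrite lerD2l ler_pdivrMr// mulVf ?gt_eqF// gerBl powR_ge0.
elim: n => [|n IH]; first by rewrite big_nat1 powR1 invr1 subrr mul0r addr0.
rewrite big_nat_recr//=; apply: le_trans (lerD IH (lexx _)) _.
rewrite -addrA lerD2l ler_pdivlMr// mulrDl mulfVK ?gt_eqF//.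
set M : R := n.+1%:R; set N : R := n.+2%:R.
have M0 : 0 < M by []. have N0 : 0 < N by [].
have -> : M `^ (1 - a) = N `^ (1 - a) * expR ((a - 1) * (ln N - ln M)).
  by rewrite /powR !gt_eqF// -expRD; congr expR; ring.
have -> : (N `^ a)^-1 = N `^ (1 - a) / N.
  exact: powR_inv_split.
have p0 : 0 <= N `^ (1 - a) by exact: powR_ge0.
have h1 : 1 + (a - 1) / N <= expR ((a - 1) * (ln N - ln M)).
  apply: le_trans (expR_ge1Dx _); rewrite lerD2l ler_wpM2l ?(ltW s0)//.
  exact: inv_le_lnB.
have := ler_wpM2l p0 h1.
by move: (expR _) N0 => E; clearbody M N => N0; lra.
Qed.

(** With N = n + 1, each term has either N - i >= N / 2, where the inverse
    square root is at most sqrt 2 / sqrt N, or i + 1 >= N / 2, where the power is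
    at most 2^a N^-a. *)
Lemma convolution_bound {R : realType} (a : R) (n : nat) : 0 <= a ->
  \sum_(0 <= i < n.+1) (i.+1%:R `^ a)^-1 / Num.sqrt (n.+1 - i)%:R <=
  Num.sqrt 2 / Num.sqrt n.+1%:R * \sum_(0 <= i < n.+1) (i.+1%:R `^ a)^-1
   + 2 `^ a * 2 * (n.+1%:R `^ a)^-1 * Num.sqrt n.+1%:R :> R.
Proof.
move=> a0; set N := n.+1.
(* Reversing the order of summation gives the power sum of exponent 1/2. *)
have sqrt_sum : \sum_(0 <= i < N) (Num.sqrt (N - i)%:R)^-1
    <= 2 * Num.sqrt N%:R :> R.
  have := @sum_powR_lt1 R 2^-1 N; rewrite -!powR12_sqrt//.
  have -> : 1 - 2^-1 = 2^-1 :> R by field.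
  rewrite invrK mulrC => h; apply: le_trans (h _); last by lra.
  rewrite big_nat_rev/= add0n big_nat [leRHS]big_nat.
  apply: ler_sum => i /andP[_ iN].
  by rewrite subKn// -powR12_sqrt.
have c0 : 0 <= 2 `^ a * (N%:R `^ a)^-1 :> R.
  by rewrite mulr_ge0 ?invr_ge0 ?powR_ge0.
apply: (@le_trans _ _ (Num.sqrt 2 / Num.sqrt N%:R *
    (\sum_(0 <= i < N) (i.+1%:R `^ a)^-1) + 2 `^ a * (N%:R `^ a)^-1 *
    (\sum_(0 <= i < N) (Num.sqrt (N - i)%:R)^-1))); last first.
  by rewrite lerD2l; apply: le_trans (ler_wpM2l c0 sqrt_sum) _; lra.
rewrite !mulr_sumr -big_split/= !big_nat; apply: ler_sum => i /andP[_ iN].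
have N0 : 0 < N%:R :> R by [].
have Ni0 : 0 < (N - i)%:R :> R by rewrite ltr0n subn_gt0.
have t1 : 0 <= Num.sqrt 2 / Num.sqrt N%:R * (i.+1%:R `^ a)^-1 :> R.
  by rewrite mulr_ge0 ?divr_ge0 ?sqrtr_ge0 ?invr_ge0 ?powR_ge0.
have t2 : 0 <= 2 `^ a * (N%:R `^ a)^-1 / Num.sqrt (N - i)%:R :> R.
  by rewrite mulr_ge0// invr_ge0 sqrtr_ge0.
have [hi|hi] := leqP N (2 * (N - i)).
  apply: ler_wpDr => //; rewrite mulrC ler_wpM2r ?invr_ge0 ?powR_ge0//.
  rewrite ler_pdivlMr ?sqrtr_gt0// mulrC ler_pdivrMr ?sqrtr_gt0//.
  by rewrite -sqrtrM// ler_sqrt ?mulr_ge0// -natrM ler_nat.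
apply: ler_wpDl => //; rewrite ler_wpM2r ?invr_ge0 ?sqrtr_ge0//.
rewrite ler_pdivlMr ?powR_gt0// mulrC ler_pdivrMr ?powR_gt0//.
rewrite -powRM// ge0_ler_powR ?nnegrE ?mulr_ge0// -natrM ler_nat.
by move: hi; rewrite mulnBr; move: iN; lia.
Qed.

(** * Rates of convergence *)

(** A big-O bound by n^-a holds for all n >= 1 once the constant absorbs the
    finitely many initial terms. *)
Lemma bigO_powR_bound {R : realType} (u : nat -> R) (a : R) :
  u =O_\oo (fun n : nat => 1 / n%:R `^ a) ->
  exists2 M : R, 0 <= M & forall n, `|u n.+1| <= M * (n.+1%:R `^ a)^-1.
Proof.
move=> /eqO_exP[k k0 [N _ uN]].
have S0 (P : pred 'I_N) : 0 <= \sum_(i < N | P i) `|u i| * i%:R `^ a.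
  by apply: sumr_ge0 => i _; rewrite mulr_ge0 ?powR_ge0.
exists (k + \sum_(i < N) `|u i| * i%:R `^ a) => [|n].
  by rewrite addr_ge0 ?S0 ?(ltW k0).
have p0 : 0 < n.+1%:R `^ a :> R by rewrite powR_gt0.
rewrite -[leRHS]/(_ / _) ler_pdivlMr//.
have [Nn|nN] := leqP N n.+1.
  have := uN _ Nn; rewrite /= div1r normfV (ger0_norm (ltW p0)).
  rewrite -[leRHS]/(_ / _) ler_pdivlMr// => /le_trans; apply.
  by rewrite lerDl S0.
by rewrite (bigD1 (Ordinal nN))//= addrCA lerDl addr_ge0 ?(ltW k0).
Qed.

(** The inequality is only required from index 2 on, where ln n is already
    positive. *)
Lemma bigO_of_le {R : realType} (u g : nat -> R) (K : R) : 0 <= K ->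
  (forall n, `|u n.+2| <= K * `|g n.+2|) -> u =O_\oo g.
Proof.
move=> K0 ug; apply/eqO_exP; exists (K + 1); first by rewrite ltr_wpDl.
exists 2%N => // -[|[|n]]//= _; apply: le_trans (ug n) _.
by rewrite ler_wpM2r// lerDl.
Qed.

(** Common form of the three rates, before the power sum is estimated. *)
Lemma inexact_km_rate {R : realType} (X : normedModType R) (C : set X)
    (T : X -> X) (alpha : nat -> R) (e x : nat -> X) (kappa delta a : R) :
  (forall u v, C u -> C v -> `|T u - T v| <= `|u - v|) ->
  0 < delta -> (forall n, delta <= alpha n.+1 <= 1 - delta) ->
  (forall n, C (x n)) -> (forall n, `|T (x n) - x 0%N| <= kappa) ->
  (forall n,
     x n.+1 = (1 - alpha n.+1) *: x n + alpha n.+1 *: (T (x n) + e n.+1)) ->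
  0 <= a -> (fun n : nat => `|e n|) =O_\oo (fun n : nat => 1 / n%:R `^ a) ->
  exists2 K : R, 0 <= K & forall n, `|x n.+1 - T (x n.+1)| <=
    K * ((1 + \sum_(0 <= i < n.+1) (i.+1%:R `^ a)^-1) / Num.sqrt n.+1%:R
         + (n.+1%:R `^ a)^-1 * Num.sqrt n.+1%:R).
Proof.
move=> Tne d0 ad Cx xk xS a0 /bigO_powR_bound[M M0 eM].
have k0 : 0 <= kappa := le_trans (normr_ge0 _) (xk 0%N).
set c := 2 / Num.sqrt (delta * (1 - delta)).
have c0 : 0 <= c by rewrite divr_ge0 ?sqrtr_ge0.
have s20 : 0 <= Num.sqrt 2 :> R by rewrite sqrtr_ge0.
have p20 : 0 <= 2 `^ a :> R by rewrite powR_ge0.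
have q0 : 0 <= 2 * M * Num.sqrt 2 by rewrite !mulr_ge0.
have q1 : 0 <= 2 * M * (2 `^ a * 2) by rewrite !mulr_ge0.
exists (c * (kappa + 2 * M * Num.sqrt 2 + 2 * M * (2 `^ a * 2))) => [|n].
  by rewrite mulr_ge0// !addr_ge0.
have := @inexact_km_bound R X C T alpha e x kappa delta Tne d0 ad Cx xk xS n.+1.
move=> /le_trans; apply; rewrite -/c -[leRHS]mulrA ler_wpM2l//.
have cv := @convolution_bound R a n a0.
have eC : \sum_(0 <= i < n.+1) `|e i.+1| / Num.sqrt (n.+1 - i)%:R <=
   M * \sum_(0 <= i < n.+1) (i.+1%:R `^ a)^-1 / Num.sqrt (n.+1 - i)%:R.
  rewrite mulr_sumr; apply: ler_sum => i _.
  by rewrite mulrA ler_wpM2r ?invr_ge0 ?sqrtr_ge0// -[leLHS]normr_id eM.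
have := le_trans eC (ler_wpM2l M0 cv).
have S0 : 0 <= \sum_(0 <= i < n.+1) (i.+1%:R `^ a)^-1 :> R.
  by apply: sumr_ge0 => i _; rewrite invr_ge0 powR_ge0.
have r0 : 0 < Num.sqrt n.+1%:R :> R by rewrite sqrtr_gt0.
have p0 : 0 <= (n.+1%:R `^ a)^-1 :> R by rewrite invr_ge0 powR_ge0.
have kr : kappa / Num.sqrt n.+2%:R <= kappa / Num.sqrt n.+1%:R.
  by rewrite ler_wpM2l// lef_pV2 ?posrE ?sqrtr_gt0// ler_sqrt// ler_nat.
move: S0 p0 kr r0; set r : R := Num.sqrt n.+1%:R.
move: (\sum_(_ <= i < _) _) (\sum_(_ <= i < _) _) (n.+1%:R `^ a)^-1.
move=> E S p S0 p0 kr r0 EM.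
have rV0 : 0 <= r^-1 by rewrite invr_ge0 ltW.
have t1 : 0 <= S / r by rewrite mulr_ge0.
have t2 : 0 <= p * r by rewrite mulr_ge0// ltW.
have m1 := mulr_ge0 k0 t1; have m2 := mulr_ge0 k0 t2.
have m3 := mulr_ge0 q0 rV0; have m4 := mulr_ge0 q0 t2.
have m5 := mulr_ge0 q1 rV0; have m6 := mulr_ge0 q1 t1.
apply: le_trans (lerD kr (ler_wpM2l (ler0n _ 2) EM)) _.
rewrite -subr_ge0; move: m1 m2 m3 m4 m5 m6.
move: (Num.sqrt 2) (2 `^ a) r^-1 => s2 pa rV; lra.
Qed.

Theorem corollary3p5 (R : realType) (X : completeNormedModType R)
  (C : set X) (closedC : closed C) (convexC : convex_set C)
  (T : {fun C >-> C}) (nonexpT : 1.-lipschitz_C T)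
  (alpha : nat -> R)
  (alpha01 : forall n : nat, (1 <= n)%N -> 0 <= alpha n <= 1)
  (e : nat -> X) (x0 : X) (x0C : C x0) (x : nat -> X) (x_init : x 0%N = x0)
  (x_rec : forall n : nat,
     x n.+1 = (1 - alpha n.+1) *: x n + alpha n.+1 *: (T (x n) + e n.+1))
  (x_bnd : exists2 kappa : R, 0 <= kappa &
     forall n : nat, C (x n) /\ `|T (x n) - x0| <= kappa)
  (alpha_bnd : bounded_away01 alpha)
  (a : R)
  (e_bigO : (fun n : nat => `|e n|) =O_\oo (fun n : nat => 1 / n%:R `^ a)) :
  [/\ 1 / 2 <= a < 1 ->
        (fun n : nat => `|x n - T (x n)|) =O_\oo
        (fun n : nat => 1 / n%:R `^ (a - 1 / 2)),
      a = 1 ->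
        (fun n : nat => `|x n - T (x n)|) =O_\oo
        (fun n : nat => ln n%:R / Num.sqrt n%:R) &
      1 < a ->
        (fun n : nat => `|x n - T (x n)|) =O_\oo
        (fun n : nat => 1 / Num.sqrt n%:R)].
Proof.
have [kappa k0 xk] := x_bnd; have [delta d0 ad] := alpha_bnd.
have Tne u v : C u -> C v -> `|T u - T v| <= `|u - v|.
  by move=> Cu Cv; have := nonexpT (u, v) (conj Cu Cv); rewrite /= mul1r.
have rate a0 := @inexact_km_rate R X C T alpha e x kappa delta a Tne d0
  (fun n => ad n.+1 isT) (fun n => (xk n).1)
  (fun n => eq_ind_r (fun y => `|T (x n) - y| <= kappa) (xk n).2 x_init)
  x_rec a0 e_bigO.
have sqrt_gt0 n : 0 < Num.sqrt n.+1%:R :> R by rewrite sqrtr_gt0.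
have sqr_sqrt n : Num.sqrt n.+1%:R * Num.sqrt n.+1%:R = n.+1%:R :> R.
  by rewrite -expr2 sqr_sqrtr.
have powB n (r s : R) : n.+1%:R `^ (r - s) = n.+1%:R `^ r / n.+1%:R `^ s.
  by rewrite powRB// pnatr_eq0 implybT.
have pow_gt0 n (r : R) : 0 < n.+1%:R `^ r by rewrite powR_gt0.
split.
- move=> /andP[a_ge a_lt1].
  have a0 : 0 <= a by lra.
  have s0 : 0 < 1 - a by lra.
  have [K K0 xK] := rate a0.
  have K1 : 0 <= (2 + (1 - a)^-1 : R) by rewrite addr_ge0// invr_ge0 ltW.
  apply: (@bigO_of_le _ _ _ (K * (2 + (1 - a)^-1))); first exact: mulr_ge0.
  move=> n; rewrite normr_id; apply: le_trans (xK n.+1) _.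
  rewrite -mulrA ler_wpM2l// div1r normfV (ger0_norm (ltW (pow_gt0 _ _))).
  (* Everything is compared with N^(1/2 - a) = N^-a sqrt N. *)
  have -> : (n.+2%:R `^ (a - 1 / 2))^-1 = (n.+2%:R `^ a)^-1 * Num.sqrt n.+2%:R :> R.
    by rewrite powB div1r powR12_sqrt// invf_div mulrC.
  have pN : n.+2%:R `^ a <= n.+2%:R :> R.
    by rewrite -[leRHS]powRr1// ler_powR ?ler1n// ltW.
  have := @sum_powR_lt1 R a n.+2; rewrite a0 a_lt1 => /(_ isT).
  rewrite powB powRr1//.
  have := sqr_sqrt n.+1; have := sqrt_gt0 n.+1; have := pow_gt0 n.+1 a.
  move: (\sum_(_ <= i < _) _) pN => S.
  move: (n.+2%:R `^ a) (Num.sqrt n.+2%:R) => p r.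
  move: (n.+2%:R : R) => N pN p0 r0 rN SN.
  have -> : (2 + (1 - a)^-1) * (p^-1 * r) =
      (N / p + N / p / (1 - a)) / r + p^-1 * r.
    by rewrite -rN; field; rewrite !gt_eqF.
  rewrite lerD2r ler_wpM2r ?invr_ge0 ?(ltW r0)// lerD//.
  by rewrite ler_pdivlMr// mul1r.
- move=> a1; have [K K0 xK] := rate ltac:(rewrite a1; exact: ler01).
  have ln2 : 0 < ln 2 :> R by rewrite ln_gt0// ltr1n.
  have K1 : 0 <= (3 / ln 2 + 1 : R) by rewrite addr_ge0// divr_ge0// ltW.
  apply: (@bigO_of_le _ _ _ (K * (3 / ln 2 + 1))); first exact: mulr_ge0.
  move=> n; rewrite normr_id; apply: le_trans (xK n.+1) _.
  have lnN : ln 2 <= ln n.+2%:R :> R by rewrite ler_ln ?posrE// ler_nat.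
  have lnN0 : 0 <= ln n.+2%:R :> R by rewrite (le_trans (ltW ln2)).
  rewrite -mulrA ler_wpM2l// ger0_norm ?divr_ge0 ?(ltW (sqrt_gt0 _))//.
  have := @sum_inv_le_ln R n.+1.
  have -> : \sum_(0 <= i < n.+2) i.+1%:R^-1
      = \sum_(0 <= i < n.+2) (i.+1%:R `^ a)^-1 :> R.
    by apply: eq_bigr => i _; rewrite a1 powRr1.
  have -> : n.+2%:R `^ a = n.+2%:R :> R by rewrite a1 powRr1.
  have := sqr_sqrt n.+1; have := sqrt_gt0 n.+1; move: lnN lnN0.
  move: (\sum_(_ <= i < _) _) (ln n.+2%:R) (Num.sqrt n.+2%:R) => S l r.
  move: (n.+2%:R : R) => N l2 l0 r0 rN Sl.
  have -> : N^-1 * r = r^-1 by rewrite -rN; field; rewrite gt_eqF.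
  rewrite -[X in _ + X]mul1r -mulrDl mulrA ler_wpM2r ?invr_ge0 ?(ltW r0)//.
  (* The constant terms are absorbed by the logarithm, as ln N >= ln 2. *)
  have : 3 <= 3 / ln 2 * l :> R by rewrite mulrAC ler_pdivlMr// ler_wpM2l.
  lra.
- move=> a1; have a0 : 0 <= a by lra.
  have s0 : 0 < a - 1 by lra.
  have [K K0 xK] := rate a0.
  have K1 : 0 <= (3 + (a - 1)^-1 : R) by rewrite addr_ge0// invr_ge0 ltW.
  apply: (@bigO_of_le _ _ _ (K * (3 + (a - 1)^-1))); first exact: mulr_ge0.
  move=> n; rewrite normr_id; apply: le_trans (xK n.+1) _.
  rewrite -mulrA ler_wpM2l// div1r normfV (ger0_norm (ltW (sqrt_gt0 _))).
  have pN : n.+2%:R <= n.+2%:R `^ a :> R.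
    by rewrite -[leLHS]powRr1// ler_powR ?ler1n// ltW.
  have := @sum_powR_gt1 R a n.+2 a1.
  have := sqr_sqrt n.+1; have := sqrt_gt0 n.+1; have := pow_gt0 n.+1 a.
  move: (\sum_(_ <= i < _) _) pN => S.
  move: (n.+2%:R `^ a) (Num.sqrt n.+2%:R) => p r.
  move: (n.+2%:R : R) => N pN p0 r0 rN Sa.
  have pr : p^-1 * r <= 1 * r^-1.
    by rewrite mul1r mulrC ler_pdivrMr// mulrC ler_pdivlMr// rN.
  apply: le_trans (lerD (lexx _) pr) _.
  by rewrite -mulrDl ler_wpM2r ?invr_ge0 ?(ltW r0)//; lra.
Qed.
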